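(* Let $G$ be a connected graph with adjacency matrix $A$, degree vector $d$, $D=\mathrm{diag}(d)$ and $P=D^{-1}A$. Let $e=(i,j)$, $i\neq j$, be an edge with $a_{ij}>0$ which is not a cut-edge (so that $d_i-a_{ij}>0$ and $d_j-a_{ij}>0$). Let $U=[e_i\ \ e_j]\in\mathbb{R}^{n\times 2}$, let \[ V^T=\begin{bmatrix} s_i&0\\0&s_j\end{bmatrix}U^TA-a_{ij}\begin{bmatrix}0&(d_i-a_{ij})^{-1}\\(d_j-a_{ij})^{-1}&0\end{bmatrix}U^T\in\mathbb{R}^{2\times n},\qquad s_i=\frac{a_{ij}}{d_i(d_i-a_{ij})},\ s_j=\frac{a_{ij}}{d_j(d_j-a_{ij})}, \] let $h\in\mathbb{R}^n$ with $h^T\mathbf 1=1$, and $Z=(I-P+\mathbf 1h^T)^{-1}$. Then $\widehat P=P+UV^T$, the $2\times 2$ matrix $I-V^TZU$ is invertible, and \[ c(e)=\operatorname{Tr}\big((I-V^TZU)^{-1}V^TZ^2U\big). \]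
   Context: Graphs are undirected and possibly weighted on vertex set $\{1,\dots,n\}$, with symmetric nonnegative adjacency matrix $A=(a_{k\ell})$; $d=A\mathbf 1$ (all entries assumed positive), $D=\mathrm{diag}(d)$, $P=D^{-1}A$; $e_k$ is the $k$-th column of the identity and $\mathbf 1$ the all-ones vector. $G$ connected means $P$ irreducible. For an irreducible row-stochastic matrix $Q$ with stationary vector $\pi$, the Kemeny constant is $K(Q)=\sum_j\pi_j m_{kj}$, where $m_{kj}$ is the expected first passage time from $k$ to $j$ ($m_{kk}=0$), independent of $k$; equivalently $K(Q)=\sum_{\ell=2}^n 1/(1-\lambda_\ell)$, where $1=\lambda_1,\lambda_2,\dots,\lambda_n$ are the eigenvalues of $Q$. Removing edge $e=(i,j)$ means replacing $A$ by $\widehat A=A-a_{ij}(e_ie_j^T+e_je_i^T)$; set $\widehat d=\widehat A\mathbf 1$, $\widehat D=\mathrm{diag}(\widehat d)$, $\widehat P=\widehat D^{-1}\widehat A$. The edge $e$ is a cut-edge if the graph with adjacency matrix $\widehat A$ is disconnected. The Kemeny-based centrality score is $c(e)=K(\widehat P)-K(P)$. *)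

(* Defs.v *)
From HB Require Import structures.
From mathcomp Require Import all_boot all_order all_algebra.
From mathcomp Require Import complex.
Set Implicit Arguments. Unset Strict Implicit. Unset Printing Implicit Defensive.
Import Order.TTheory GRing.Theory Num.Theory.
Local Open Scope ring_scope.

Section Defs.
Variable R : rcfType.

Definition degvec (n : nat) (A : 'M[R]_n) : 'cV[R]_n := A *m const_mx 1.

Definition transmx (n : nat) (A : 'M[R]_n) : 'M[R]_n :=
  invmx (diag_mx (degvec A)^T) *m A.

Definition remove_edge (n : nat) (A : 'M[R]_n) (i j : 'I_n) : 'M[R]_n :=
  A - A i j *: (delta_mx i j + delta_mx j i).

Definition irreducible_mx (n : nat) (Q : 'M[R]_n) : Prop :=
  forall k l : 'I_n, exists m : nat, 0 < (Q ^+ m) k l.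

Definition connected_adj (n : nat) (A : 'M[R]_n) : Prop :=
  irreducible_mx (transmx A).

(* a multiset (sequence) of the eigenvalues of Q in R[i], with multiplicity:
   char_poly Q = \prod_(z <- eigs Q) ('X - z) *)
Definition eigs (n : nat) (Q : 'M[R]_n) : seq R[i] :=
  sval (closed_field_poly_normal (char_poly (map_mx (real_complex R) Q))).

(* Kemeny constant: sum over l >= 2 of 1/(1 - lambda_l), where lambda_1 = 1
   is removed (one occurrence) from the list of eigenvalues. *)
Definition kemeny (n : nat) (Q : 'M[R]_n) : R[i] :=
  \sum_(z <- rem 1 (eigs Q)) (1 - z)^-1.

Definition kemeny_score (n : nat) (A : 'M[R]_n) (i j : 'I_n) : R[i] :=
  kemeny (transmx (remove_edge A i j)) - kemeny (transmx A).

Definition mx2 (a b c d : R) : 'M[R]_2 :=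
  \matrix_(r < 2, s < 2)
    if r == 0 then (if s == 0 then a else b) else (if s == 0 then c else d).

End Defs.

(* Main.v *)
(* For [Q] row-stochastic and [h^T 1 = 1], the matrix [Q - 1 h^T] has the
   eigenvalues of [Q] with one eigenvalue [1] replaced by [0]; hence
   [K(Q) = tr ((I - Q + 1 h^T)^-1) - 1].  Since removing the edge perturbs [P]
   by the rank two matrix [U V^T], the difference of the two traces is read off
   the Woodbury identity.  Both matrices [I - Q + 1 h^T] are invertible: pairing
   a kernel vector [x] with the stationary vector [d] gives [h^T x = 0], so [x]
   is harmonic, hence constant by irreducibility, hence zero. *)

Require Import Defs.
From HB Require Import structures.
From mathcomp Require Import all_boot all_order all_algebra.
From mathcomp Require Import complex.
From mathcomp Require Import perm ring.

Set Implicit Arguments.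
Import Order.TTheory GRing.Theory Num.Theory.
Local Open Scope ring_scope.

(** * Characteristic polynomials: derivative at 1 and deflation *)

Lemma deriv_prod_uniq (R : comNzRingType) (I : eqType) (r : seq I)
  (f : I -> {poly R}) :
  uniq r ->
  (\prod_(i <- r) f i)^`()
  = \sum_(i <- r) (f i)^`() * \prod_(k <- r | i != k) f k.
Proof.
elim: r => [|x r IHr] /=; first by rewrite !big_nil derivC.
case/andP=> xr ur; rewrite !big_cons derivM IHr // eqxx /=.
congr (_ * _ + _).
  by rewrite big_seq [RHS]big_seq_cond; apply: eq_bigl => k;
     case: eqVneq => [<-|]; rewrite ?(negbTE xr) ?andbT.
rewrite mulr_sumr [LHS]big_seq [RHS]big_seq; apply: eq_bigr => k kr.
rewrite big_cons; case: eqVneq => [kx|_]; last by rewrite mulrCA.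
by rewrite -kx kr in xr.
Qed.

(** Jacobi's formula for ['X - M]: in the Leibniz expansion an entry has derivative 1 on the
    diagonal and 0 off it, so only fixed points of a permutation contribute, and they assemble into
    the diagonal cofactors. *)
Lemma deriv_char_poly (R : comNzRingType) (n : nat) (M : 'M[R]_n) :
  (char_poly M)^`() = \tr (\adj (char_poly_mx M)).
Proof.
rewrite /char_poly /determinant raddf_sum /=.
transitivity (\sum_(s : 'S_n) \sum_(k | s k == k)
    (-1) ^+ s * \prod_(l | k != l) char_poly_mx M l (s l)).
  apply: eq_bigr => s _.
  rewrite -[(-1) ^+ s]/(GRing.sign _ (s : bool)) mulr_sign.
  rewrite (fun_if (fun p => p^`())) derivN -mulr_sign.
  rewrite deriv_prod_uniq ?index_enum_uniq // mulr_sumr [RHS]big_mkcond /=.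
  apply: eq_bigr => k _; rewrite !mxE derivB derivC subr0 eq_sym.
  by case: eqP => _; rewrite ?derivX ?mul1r // derivC mul0r mulr0.
(* For fixed [k], the permutations fixing [k] sum to the cofactor at [(k, k)]. *)
rewrite (exchange_big_dep predT) //=; apply: eq_bigr => k _.
by rewrite mxE expand_cofactor.
Qed.

(** Jacobi's formula evaluated at 1, where the characteristic matrix becomes [1%:M - M], whose
    inverse is its adjugate over its determinant. *)
Lemma mxtrace_invmx_one_sub (F : fieldType) (n : nat) (M : 'M[F]_n) :
  1%:M - M \in unitmx ->
  \tr (invmx (1%:M - M)) = (char_poly M)^`().[1] / (char_poly M).[1].
Proof.
move=> uM; have E : map_mx (horner_eval 1) (char_poly_mx M) = 1%:M - M.
  apply/matrixP=> k l; rewrite !mxE /horner_eval hornerD hornerN hornerC.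
  by rewrite hornerMn hornerX.
rewrite deriv_char_poly /char_poly -/(horner_eval 1 _) -/(horner_eval 1 (\det _)).
rewrite -det_map_mx -trace_map_mx map_mx_adj E /invmx uM mxtraceZ.
by rewrite mulrC.
Qed.

Lemma horner_deriv_prod_XsubC (F : fieldType) (s : seq F) (x : F) :
  x \notin s ->
  let q := \prod_(z <- s) ('X - z%:P) in
  q^`().[x] / q.[x] = \sum_(z <- s) (x - z)^-1.
Proof.
elim: s => [|y s IHs] /=; first by rewrite !big_nil derivC horner0 mul0r.
rewrite inE negb_or => /andP[xy xs]; rewrite !big_cons derivM derivXsubC mul1r.
rewrite !hornerE -IHs //.
have q0 : (\prod_(z <- s) ('X - z%:P)).[x] != 0.
  by rewrite -/(root _ x) root_prod_XsubC.
have xy0 : x - y != 0 by rewrite subr_eq0.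
by field; rewrite q0 xy0.
Qed.

(* Both sides are [t * \det] of the bordered matrix [[1, -v], [u, t]]; stated
   without division by [t]. *)
Lemma det_rank1_update (R : idomainType) (n : nat) (t : R)
  (u : 'cV[R]_n) (v : 'rV[R]_n) :
  t * \det (t%:M + u *m v) = (t + (v *m u) 0 0) * t ^+ n.
Proof.
pose B : 'M_(1 + n) := block_mx 1%:M (- v) u t%:M.
have E1 : \det B = \det (t%:M + u *m v).
  have -> : B = block_mx 1%:M 0 u 1%:M *m block_mx 1%:M (- v) 0 (t%:M + u *m v).
    rewrite mulmx_block !(mul1mx, mulmx1, mul0mx, mulmx0, addr0, add0r) /B.
    by rewrite mulmxN addrCA addNr addr0.
  by rewrite det_mulmx det_lblock det_ublock !det1 !mul1r.
(* Right multiplication by the block matrix [[[t, 0], [-u, 1]]], of determinant [t], clears the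
   lower left block of [B]. *)
have E2 : \det B * t = (t + (v *m u) 0 0) * t ^+ n.
  have := det_mulmx B (block_mx t%:M 0 (- u) 1%:M).
  rewrite det_lblock det1 mulr1 det_scalar expr1 => <-.
  rewrite /B mulmx_block !(mul1mx, mulmx1, mul0mx, mulmx0, addr0, add0r).
  rewrite mulNmx mulmxN opprK mul_mx_scalar mul_scalar_mx scalerN subrr.
  by rewrite det_ublock det_scalar [_ + _]mx11_scalar det_scalar expr1 !mxE eqxx.
by rewrite -E1 mulrC.
Qed.

(** Since [('X - Q) u = ('X - 1) u], the product [('X - Q)(('X - 1) + u v)] equals
    [('X - 1)('X - Q + u v)]; determinants then compare the two characteristic polynomials. *)
Lemma char_poly_deflate (F : fieldType) (n : nat) (Q : 'M[F]_n)
  (u : 'cV[F]_n) (v : 'rV[F]_n) :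
  Q *m u = u -> v *m u = 1%:M ->
  ('X - 1) * char_poly (Q - u *m v) = 'X * char_poly Q.
Proof.
move=> Qu vu; pose t : {poly F} := 'X - 1.
have t0 : t != 0 by rewrite -size_poly_eq0 size_XsubC.
pose up := map_mx polyC u; pose vp := map_mx polyC v.
have E : char_poly_mx Q *m (t%:M + up *m vp)
       = t *: char_poly_mx (Q - u *m v).
  have tu : char_poly_mx Q *m up = t *: up.
    by rewrite mulmxBl -map_mxM Qu mul_scalar_mx scalerBl scale1r.
  rewrite mulmxDr mul_mx_scalar mulmxA tu -scalemxAl -scalerDr.
  by rewrite /char_poly_mx map_mxB map_mxM opprB addrCA addrC.
have := congr1 determinant E; rewrite det_mulmx detZ -/(char_poly _).
move/(congr1 ( *%R t)); rewrite mulrCA det_rank1_update.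
rewrite -map_mxM vu !mxE /= -/(char_poly _) => H.
have tn0 : t ^+ n != 0 by rewrite expf_neq0.
apply: (mulfI tn0); rewrite mulrCA -H /t subrK.
ring.
Qed.

(** Deflation trades one eigenvalue 1 for 0, and this 0 contributes [1 / (1 - 0)] to the trace:
    hence the final [- 1]. *)
Lemma sum_inv_eigenvalues (F : fieldType) (n : nat) (Q : 'M[F]_n)
  (u : 'cV[F]_n) (v : 'rV[F]_n) (s : seq F) :
  Q *m u = u -> v *m u = 1%:M -> 1%:M - Q + u *m v \in unitmx ->
  char_poly Q = \prod_(z <- s) ('X - z%:P) ->
  \sum_(z <- rem 1 s) (1 - z)^-1 = \tr (invmx (1%:M - Q + u *m v)) - 1.
Proof.
move=> Qu vu uM Es; have H := char_poly_deflate Qu vu.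
have s1 : 1 \in s.
  rewrite -root_prod_XsubC -Es /root; move/(congr1 (fun p => p.[1])): H.
  by rewrite !hornerE subrr mul0r => <-.
have E : char_poly (Q - u *m v) = \prod_(z <- 0 :: rem 1 s) ('X - z%:P).
  have t0 : 'X - 1 != 0 :> {poly F} by rewrite -size_poly_eq0 size_XsubC.
  apply: (mulfI t0); rewrite H Es (perm_big _ (perm_to_rem s1)) /= !big_cons.
  by rewrite subr0 mulrCA.
have EM : 1%:M - Q + u *m v = 1%:M - (Q - u *m v)
  by rewrite opprB addrAC addrA.
(* An eigenvalue 1 of the deflated matrix would give a nonzero left kernel vector of the invertible
   [1%:M - Q + u *m v]. *)
have r1 : 1 \notin 0 :: rem 1 s.
  rewrite -root_prod_XsubC -E -eigenvalue_root_char; apply/negP => /eigenvalueP[w].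
  move=> /eqP; rewrite scale1r eq_sym -subr_eq0 -{1}[w]mulmx1 -mulmxBr -EM => /eqP w0.
  by rewrite -(mulmxK uM w) w0 mul0mx eqxx.
rewrite EM mxtrace_invmx_one_sub -?EM // E horner_deriv_prod_XsubC //.
by rewrite big_cons subr0 invr1 addrAC subrr add0r.
Qed.

(** * Inverses of perturbed and diagonal matrices *)

(** With [Y] the inverse of [M - U *m V], the small matrix has the explicit inverse
    [1%:M + V *m Y *m U]; its invertibility is thus a conclusion. *)
Lemma invmx_woodbury (R : comUnitRingType) (n k : nat) (M : 'M[R]_n)
  (U : 'M[R]_(n, k)) (V : 'M[R]_(k, n)) :
  M \in unitmx -> M - U *m V \in unitmx ->
  1%:M - V *m invmx M *m U \in unitmx /\
  invmx (M - U *m V) - invmx M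
  = invmx M *m U *m invmx (1%:M - V *m invmx M *m U) *m V *m invmx M.
Proof.
move=> uM uN; set N := M - U *m V; set Z := invmx M; set Y := invmx N.
have UV : U *m V = M - N by rewrite /N opprB addrC subrK.
have ZY : Z *m (U *m V) *m Y = Y - Z.
  by rewrite UV mulmxBr mulmxBl mulVmx // mul1mx -mulmxA mulmxV // mulmx1.
have YZ : Y *m (U *m V) *m Z = Y - Z.
  by rewrite UV mulmxBr mulmxBl mulVmx // mul1mx -mulmxA mulmxV // mulmx1.
have E : (1%:M - V *m Z *m U) *m (1%:M + V *m Y *m U) = 1%:M.
  rewrite mulmxDr mulmx1 mulmxBl mul1mx.
  have -> : V *m Z *m U *m (V *m Y *m U) = V *m (Z *m (U *m V) *m Y) *m U.
    by rewrite !mulmxA.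
  by rewrite ZY mulmxBr mulmxBl subKr subrK.
have [uS _] := mulmx1_unit E.
have I : invmx (1%:M - V *m Z *m U) = 1%:M + V *m Y *m U.
  by rewrite -[LHS]mulmx1 -{2}E mulKmx.
split=> //; rewrite I mulmxDr mulmx1 !mulmxDl.
have -> : Z *m U *m (V *m Y *m U) *m V *m Z
   = Z *m (U *m V) *m (Y *m (U *m V) *m Z) by rewrite !mulmxA.
by rewrite YZ -[Z *m U *m V]mulmxA -mulmxDr [Z + _]addrC subrK ZY.
Qed.

Lemma invmx_diag_mulE (F : fieldType) (n p : nat) (v : 'rV[F]_n)
  (B : 'M[F]_(n, p)) (k : 'I_n) (l : 'I_p) :
  (forall k, v 0 k != 0) -> (invmx (diag_mx v) *m B) k l = B k l / v 0 k.
Proof.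
move=> v0; have E : diag_mx (\row_m (v 0 m)^-1) *m diag_mx v = 1%:M.
  by apply/matrixP=> q r; rewrite mul_diag_mx !mxE mulrnAr mulVf.
have [_ uD] := mulmx1_unit E.
rewrite -[invmx _]mul1mx -E mulmxK //.
by rewrite mul_diag_mx !mxE mulrC.
Qed.

(** * Random walks: stationarity, harmonic vectors, Kemeny constant *)

Section Graph.
Variable R : rcfType.

Lemma transmxE (n : nat) (A : 'M[R]_n) (k l : 'I_n) :
  (forall k, 0 < degvec A k 0) -> transmx A k l = A k l / degvec A k 0.
Proof.
move=> dpos; rewrite /transmx invmx_diag_mulE => [|m]; first by rewrite [_^T _ _]mxE.
by rewrite mxE gt_eqF.
Qed.

Lemma degvecE (n : nat) (A : 'M[R]_n) (k : 'I_n) :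
  degvec A k 0 = \sum_l A k l.
Proof. by rewrite !mxE; apply: eq_bigr => l _; rewrite mxE mulr1. Qed.

Lemma transmx_stochastic (n : nat) (A : 'M[R]_n) :
  (forall k, 0 < degvec A k 0) ->
  transmx A *m const_mx 1 = const_mx 1 :> 'cV_n.
Proof.
move=> dpos; apply/colP => k; rewrite mxE [RHS]mxE.
under eq_bigr => l _ do rewrite [const_mx _ _ _]mxE mulr1 transmxE //.
by rewrite -mulr_suml -degvecE divff // gt_eqF.
Qed.

(** Detailed balance: the degree times the transition probability is the symmetric weight [A k l].
    No normalisation is made. *)
Lemma degvec_stationary (n : nat) (A : 'M[R]_n) :
  A^T = A -> (forall k, 0 < degvec A k 0) ->
  (degvec A)^T *m transmx A = (degvec A)^T.
Proof.
move=> symA dpos; apply/rowP => l; rewrite [RHS]mxE degvecE mxE.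
apply: eq_bigr => k _; rewrite mxE transmxE // mulrC divfK ?gt_eqF //.
by rewrite -[in LHS]symA mxE.
Qed.

Lemma mx_pow_ge0 (n : nat) (Q : 'M[R]_n) (m : nat) :
  (forall k l, 0 <= Q k l) -> forall k l, 0 <= (Q ^+ m) k l.
Proof.
move=> Q0; elim: m => [|m IHm] k l; first by rewrite expr0 mxE ler0n.
by rewrite exprS mxE sumr_ge0 // => p _; rewrite mulr_ge0.
Qed.

Lemma mx_pow_fix (n : nat) (Q : 'M[R]_n) (m : nat) (x : 'cV[R]_n) :
  Q *m x = x -> Q ^+ m *m x = x.
Proof.
by move=> Qx; elim: m => [|m IHm]; rewrite ?mul1mx // exprS -mulmxA IHm.
Qed.

(* Maximum principle, applied to a power of [Q] joining a maximum point of [x]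
   to the given vertex. *)
Lemma irreducible_harmonic_const (n : nat) (Q : 'M[R]_n) (x : 'cV[R]_n) :
  (forall k l, 0 <= Q k l) -> Q *m const_mx 1 = const_mx 1 :> 'cV_n ->
  irreducible_mx Q -> Q *m x = x -> exists c, x = const_mx c.
Proof.
move=> Q0 Q1 irrQ Qx.
case: n => [|n] in Q x Q0 Q1 irrQ Qx *.
  by exists 0; apply/colP => -[].
case: (Order.TotalTheory.arg_maxP (fun k => x k 0) (erefl true : predT ord0)) => k _ kmax.
exists (x k 0); apply/colP => l; rewrite mxE; have [m Qm] := irrQ k l.
(* Row [k] of [Q ^+ m] has sum 1 and averages [x] to [x k 0], so the nonnegative gaps below the
   maximum average to zero. *)
have S : \sum_p (Q ^+ m) k p * (x k 0 - x p 0) = 0.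
  under eq_bigr => p _ do rewrite mulrBr.
  rewrite sumrB -mulr_suml.
  have /colP/(_ k) := mx_pow_fix m Q1; rewrite !mxE => H1.
  have /colP/(_ k) := mx_pow_fix m Qx; rewrite !mxE => ->.
  rewrite -[X in X * _](_ : 1 = _) ?mul1r ?subrr // -H1.
  by apply: eq_bigr => p _; rewrite mxE mulr1.
have T p : 0 <= (Q ^+ m) k p * (x k 0 - x p 0).
  by rewrite mulr_ge0 ?mx_pow_ge0 // subr_ge0; apply: kmax.
move/psumr_eq0P: S => /(_ (fun p _ => T p) l isT)/eqP.
by rewrite mulf_eq0 gt_eqF //= subr_eq0 eq_sym => /eqP.
Qed.

Lemma fundamental_unitmx (n : nat) (Q : 'M[R]_n) (w h : 'cV[R]_n) :
  (forall k l, 0 <= Q k l) -> Q *m const_mx 1 = const_mx 1 :> 'cV_n ->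
  irreducible_mx Q -> w^T *m Q = w^T -> (w^T *m const_mx 1 : 'M_1) 0 0 != 0 ->
  h^T *m const_mx 1 = 1%:M ->
  1%:M - Q + const_mx 1 *m h^T \in unitmx.
Proof.
move=> Q0 Q1 irrQ wQ w1 h1; set M := _ + _.
have [c wc] : exists c, w^T *m const_mx 1 = c%:M.
  by exists ((w^T *m const_mx 1 : 'M_1) 0 0); exact: mx11_scalar.
rewrite wc mxE mulr1n in w1.
have ker0 (x : 'cV_n) : M *m x = 0 -> x = 0.
  (* [w^T M] collapses to [(w^T 1) h^T] because [w] is stationary. *)
  move=> Mx; have hx : h^T *m x = 0.
    have : w^T *m (M *m x) = 0 by rewrite Mx mulmx0.
    rewrite mulmxA mulmxDr mulmxBr mulmx1 wQ subrr add0r -!mulmxA mulmxA.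
    rewrite wc mul_scalar_mx => /eqP.
    by rewrite scaler_eq0 (negbTE w1) => /eqP.
  have Qx : Q *m x = x.
    apply/esym/eqP; rewrite -subr_eq0; apply/eqP; rewrite -[RHS]Mx mulmxDl.
    by rewrite mulmxBl mul1mx -mulmxA hx mulmx0 addr0.
  have [b xb] := irreducible_harmonic_const Q0 Q1 irrQ Qx.
  have {}xb : x = b *: const_mx 1 by rewrite scalemx_const mulr1.
  move: hx; rewrite xb -scalemxAr h1 => /matrixP/(_ 0 0).
  by rewrite !mxE eqxx mulr1 => ->; rewrite scale0r.
(* [kermx] is a left kernel, whereas [ker0] concerns column vectors; hence the transposition. *)
rewrite -unitmx_tr -row_free_unit -kermx_eq0; apply/eqP/row_matrixP => k.
rewrite row0; apply: trmx_inj; rewrite trmx0; apply: ker0.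
by apply: trmx_inj; rewrite trmx_mul trmxK -row_mul mulmx_ker row0 trmx0.
Qed.

(** Deflation with [u] the all-ones vector and [v = h^T], carried out over [R[i]], where the
    eigenvalues live; the trace itself descends to [R]. *)
Lemma kemeny_fundamental (n : nat) (Q : 'M[R]_n) (h : 'cV[R]_n) :
  Q *m const_mx 1 = const_mx 1 :> 'cV_n -> h^T *m const_mx 1 = 1%:M ->
  1%:M - Q + const_mx 1 *m h^T \in unitmx ->
  kemeny Q = (\tr (invmx (1%:M - Q + const_mx 1 *m h^T)) - 1)%:C%C.
Proof.
move=> Q1 h1 uM; pose f := real_complex R.
have Es : char_poly (map_mx f Q) = \prod_(z <- eigs Q) ('X - z%:P).
  rewrite /eigs; case: closed_field_poly_normal => s /= {1}->.
  by rewrite (monicP (char_poly_monic _)) scale1r.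
have fM : map_mx f (1%:M - Q + const_mx 1 *m h^T)
   = 1%:M - map_mx f Q + map_mx f (const_mx 1) *m map_mx f h^T.
  by rewrite map_mxD map_mxB map_mx1 map_mxM.
rewrite /kemeny.
rewrite (@sum_inv_eigenvalues _ _ (map_mx f Q) (map_mx f (const_mx 1)) (map_mx f h^T)) //.
- by rewrite -fM -map_invmx trace_map_mx rmorphB rmorph1.
- by rewrite -map_mxM Q1.
- by rewrite -map_mxM h1 map_mx1.
- by rewrite -fM map_unitmx.
Qed.

Lemma transmx_fundamental (n : nat) (A : 'M[R]_n) (h : 'cV[R]_n) :
  (0 < n)%N -> A^T = A -> (forall k l, 0 <= A k l) ->
  (forall k, 0 < degvec A k 0) -> connected_adj A ->
  h^T *m const_mx 1 = 1%:M ->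
  1%:M - transmx A + const_mx 1 *m h^T \in unitmx.
Proof.
move=> n0 symA A0 dpos conA h1; apply: (@fundamental_unitmx _ _ (degvec A)) => //.
- by move=> k l; rewrite transmxE // divr_ge0 // ltW.
- exact: transmx_stochastic.
- exact: degvec_stationary.
have -> : ((degvec A)^T *m const_mx 1 : 'M_1) 0 0 = \sum_k degvec A k 0.
  rewrite mxE; apply: eq_bigr => k _.
  by rewrite [_^T _ _]mxE [const_mx _ _ _]mxE mulr1.
rewrite gt_eqF // (bigD1 (Ordinal n0)) //= ltr_wpDr //.
by apply: sumr_ge0 => k _; rewrite ltW.
Qed.

(** * Effect of deleting an edge *)

Lemma remove_edgeE (n : nat) (A : 'M[R]_n) (i j k l : 'I_n) :
  i != j ->
  remove_edge A i j k l
  = A k l - A i j *+ ((k == i) && (l == j) || (k == j) && (l == i)).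
Proof.
move=> ij; rewrite !mxE -[in RHS]mulr_natr; congr (_ - _ * _).
case: (eqVneq k i) => [->|_] /=; last by rewrite add0r.
by rewrite (negbTE ij) orbF addr0.
Qed.

Lemma remove_edge_sym (n : nat) (A : 'M[R]_n) (i j : 'I_n) :
  A^T = A -> (remove_edge A i j)^T = remove_edge A i j.
Proof.
move=> symA; rewrite /remove_edge linearB linearZ linearD /= symA !trmx_delta.
by rewrite [delta_mx j i + _]addrC.
Qed.

Lemma degvec_remove_edge (n : nat) (A : 'M[R]_n) (i j k : 'I_n) :
  degvec (remove_edge A i j) k 0
  = degvec A k 0 - A i j * ((k == i)%:R + (k == j)%:R).
Proof.
rewrite /degvec /remove_edge mulmxBl mxE; congr (_ + _).
rewrite mxE -scalemxAl mulmxDl; congr (- _); rewrite mxE; congr (_ * _).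
have E p q : (delta_mx p q *m (const_mx 1 : 'cV[R]_n)) k 0 = (k == p)%:R.
  rewrite mxE (bigD1 q) //= big1 ?addr0 => [|l lq]; rewrite !mxE ?eqxx ?andbT ?mulr1 //.
  by rewrite (negbTE lq) andbF.
by rewrite mxE !E.
Qed.

(* [invmx] is the identity on singular matrices, so a vanishing degree produces
   a zero row of [transmx A]; this is incompatible with irreducibility. *)
Lemma connected_adj_degvec_gt0 (n : nat) (A : 'M[R]_n) :
  (1 < n)%N -> (forall k l, 0 <= A k l) -> connected_adj A ->
  forall k, 0 < degvec A k 0.
Proof.
move=> n1 A0 conA k; have dge0 p : 0 <= degvec A p 0.
  by rewrite degvecE sumr_ge0.
rewrite lt_neqAle dge0 andbT eq_sym; apply/negP => /eqP dk.
have Ak l : A k l = 0.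
  by move: dk; rewrite degvecE => /psumr_eq0P ->.
have [l kl] : exists l, l != k.
  exists (if k == Ordinal (ltnW n1) then Ordinal n1 else Ordinal (ltnW n1)).
  by case: ifP => [/eqP ->|] //; rewrite eq_sym => ->.
have nuD : diag_mx (degvec A)^T \notin unitmx.
  rewrite unitmxE det_diag (bigD1 k) //= [_^T _ _]mxE dk mul0r.
  by rewrite unitr0.
have Pk p : transmx A k p = 0.
  by rewrite /transmx invmx_out // mul_diag_mx mxE Ak mulr0.
(* The zeroth power is the identity, which vanishes at [(k, l)] as [l != k]; every higher power
   inherits the zero row [k]. *)
have [[|m]] := conA k l.
  by rewrite expr0 mxE eq_sym (negbTE kl) ltxx.
by rewrite exprS mxE big1 ?ltxx // => p _; rewrite Pk mul0r.
Qed.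

End Graph.

Lemma mul_mx2E (R : rcfType) (n : nat) (a b c d : R) (M : 'M[R]_(2, n))
  (r : 'I_2) (l : 'I_n) :
  (mx2 a b c d *m M) r l
  = if r == 0 then a * M 0 l + b * M 1 l else c * M 0 l + d * M 1 l.
Proof.
rewrite mxE !big_ord_recl big_ord0 addr0 !mxE /=.
have -> : lift ord0 ord0 = 1 :> 'I_2 by apply/val_inj.
by case: ifP.
Qed.

(** That the edge is not a cut-edge is expressed by connectedness after deletion; positivity of the
    reduced degrees follows from it. *)
Theorem theorem4 (R : rcfType) (n : nat) (A : 'M[R]_n) (i j : 'I_n)
  (h : 'cV[R]_n) :
  A^T = A ->
  (forall k l, 0 <= A k l) ->
  (forall k, 0 < degvec A k 0) ->
  connected_adj A ->
  i != j ->
  0 < A i j ->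
  connected_adj (remove_edge A i j) ->
  h^T *m const_mx 1 = 1%:M ->
  let d := degvec A in
  let a := A i j in
  let P := transmx A in
  let U : 'M[R]_(n, 2) := row_mx (col i 1%:M) (col j 1%:M) in
  let s_i := a / (d i 0 * (d i 0 - a)) in
  let s_j := a / (d j 0 * (d j 0 - a)) in
  let VT : 'M[R]_(2, n) :=
    mx2 s_i 0 0 s_j *m U^T *m A
    - a *: (mx2 0 (d i 0 - a)^-1 (d j 0 - a)^-1 0 *m U^T) in
  let Z := invmx (1%:M - P + const_mx 1 *m h^T) in
  [/\ transmx (remove_edge A i j) = P + U *m VT,
      1%:M - VT *m Z *m U \in unitmx
    & kemeny_score A i j
      = (\tr (invmx (1%:M - VT *m Z *m U) *m VT *m (Z *m Z) *m U))%:C%C].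
Proof.
move=> symA A0 dpos conA ij aij conB h1 d a P U s_i s_j VT Z.
have n1 : (1 < n)%N.
  rewrite ltnNge; apply/negP => n1; case/negP: ij.
  move: (leq_trans (ltn_ord i) n1) (leq_trans (ltn_ord j) n1).
  by rewrite !ltnS !leqn0 -val_eqE => /eqP /= -> /eqP ->.
set B := remove_edge A i j in conB *.
have B0 k l : 0 <= B k l.
  rewrite remove_edgeE //; case E: (_ || _); last by rewrite subr0.
  have aji : A j i = A i j by rewrite -[in LHS]symA mxE.
  by case/orP: E => /andP[/eqP -> /eqP ->]; rewrite ?aji subrr.
have bpos := connected_adj_degvec_gt0 n1 B0 conB.
have PB : transmx B = P + U *m VT.
  have dB k : degvec B k 0 = d k 0 - a * ((k == i)%:R + (k == j)%:R).
    exact: degvec_remove_edge.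
  have dn0 k : d k 0 != 0 by rewrite gt_eqF.
  have di0 : d i 0 - a != 0.
    by have := bpos i; rewrite dB eqxx (negbTE ij) addr0 mulr1 => /gt_eqF ->.
  have dj0 : d j 0 - a != 0.
    by have := bpos j; rewrite dB eqxx eq_sym (negbTE ij) add0r mulr1 => /gt_eqF ->.
  have UE k r : U k r = (k == if r == 0 then i else j)%:R.
    rewrite /U mxE; case: splitP => q; rewrite ord1 !mxE => r0.
      by rewrite -[r == 0]val_eqE /= r0.
    by rewrite -[r == 0]val_eqE /= r0.
  apply/matrixP=> k l; rewrite [RHS]mxE !transmxE // dB -/d.
  rewrite [(U *m VT) k l]mxE !big_ord_recl big_ord0 addr0 !UE /=.
  have VE r : VT r l =
      if r == 0 then s_i * A i l - a * ((d i 0 - a)^-1 * (l == j)%:R)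
      else s_j * A j l - a * ((d j 0 - a)^-1 * (l == i)%:R).
    have UA q : (U^T *m A) q l = A (if q == 0 then i else j) l.
      rewrite mxE (bigD1 (if q == 0 then i else j)) //= big1 => [|p pq].
        by rewrite addr0 mxE UE eqxx mul1r.
      by rewrite mxE UE (negbTE pq) mul0r.
    rewrite /VT -mulmxA [LHS]mxE mul_mx2E [X in _ + X]mxE [X in - X]mxE mul_mx2E.
    rewrite !UA ![U^T _ _]mxE !UE /=.
    by case: ifP => _; rewrite !mul0r ?addr0 ?add0r.
  rewrite !VE /= remove_edgeE //.
  (* Rests on [1/(y - a) = 1/y + a/(y (y - a))], the source of [s_i] and [s_j]. Here [y] is the old
     degree and [w] the indicator of the lost neighbour. *)
  have row_update (x y w : R) : y != 0 -> y - a != 0 ->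
      (x - a * w) / (y - a) = x / y + (a / (y * (y - a)) * x - a * ((y - a)^-1 * w)).
    by move=> y0 ya0; field; rewrite y0 ya0.
  rewrite -/a -[a *+ _]mulr_natr; have [->|ki] := eqVneq k i.
    by rewrite (negbTE ij) orbF addr0 mulr1 mul1r mul0r addr0 row_update.
  have [->|kj] := eqVneq k j; last by rewrite addr0 mulr0 !subr0 !mul0r !addr0.
  by rewrite add0r mulr1 mul1r mul0r add0r row_update.
have uM := transmx_fundamental (ltnW n1) symA A0 dpos conA h1.
have symB : B^T = B by exact: remove_edge_sym.
have uN := transmx_fundamental (ltnW n1) symB B0 bpos conB h1.
have EN : 1%:M - transmx B + const_mx 1 *m h^T
   = 1%:M - P + const_mx 1 *m h^T - U *m VT.
  by rewrite PB opprD addrA [RHS]addrAC.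
have uN' := uN; rewrite EN in uN'.
have [uS ES] := @invmx_woodbury _ _ _ _ _ _ uM uN'.
(* Using the same [h] for both graphs, the two terms [- 1] cancel and the score is a difference of
   traces of inverses. *)
split=> //; rewrite /kemeny_score -/B !(@kemeny_fundamental _ _ _ h) //;
  try exact: transmx_stochastic.
rewrite -rmorphB /= opprB addrA subrK EN -raddfB /= ES -/Z.
congr (_%:C)%C.
(* Cyclicity of the trace moves the leading [Z *m U] to the end, where the two factors [Z] meet. *)
by rewrite -!(mulmxA (Z *m U)) mxtrace_mulC !mulmxA.
Qed.
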